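(* Let $\alpha\ge0$ and let $f:\mathbb{N}_0\to\mathbb{C}$ be a sequence with finite support. Then $$W^\alpha S(t)f(n)=e^{-tn}\sum_{j=n}^\infty\binom{j+\alpha}{n+\alpha}(1-e^{-t})^{j-n}\,W^\alpha f(j),\qquad t\ge0,\ n\in\mathbb{N}_0.$$ As a consequence, $$k^{\alpha+1}\,W^\alpha(S(t)f)=S(t)\big(k^{\alpha+1}\,W^\alpha f\big),\qquad t\ge0,$$ where products of sequences are pointwise.
   Context: $\mathbb{N}_0=\{0,1,2,\ldots\}$ and $0^0=1$. Generalized binomial coefficients are $\binom{x}{y}=\frac{\Gamma(x+1)}{\Gamma(y+1)\Gamma(x-y+1)}$. For $\gamma\in\mathbb{C}$ put $k^\gamma(0)=1$ and $k^\gamma(n)=\frac{\gamma(\gamma+1)\cdots(\gamma+n-1)}{n!}$ for $n\ge1$. For $t\ge0$, $$S(t)f(n)=e^{-tn}\sum_{j=n}^\infty\binom jn(1-e^{-t})^{j-n}f(j),\qquad n\in\mathbb{N}_0.$$ Fractional differences: for $f:\mathbb{N}_0\to\mathbb{C}$ and $\alpha>0$, $W^{-\alpha}f(n)=\sum_{j=n}^\infty k^\alpha(j-n)f(j)$ whenever this makes sense; $W^1f(n)=f(n)-f(n+1)$, $W^m$ is the $m$-fold iterate of $W^1$ for integers $m\ge1$; and for $\alpha>0$, $W^\alpha f=W^mW^{-(m-\alpha)}f$ with $m=[\alpha]+1$, whenever this makes sense (for integer $\alpha$ this is the iterated difference). $W^0$ is the identity. *)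

(* Defs.v *)
From HB Require Import structures.
From mathcomp Require Import all_boot all_order all_algebra.
From mathcomp Require Import complex.
From mathcomp Require Import all_classical all_reals all_analysis.

Set Implicit Arguments.
Unset Strict Implicit.
Unset Printing Implicit Defensive.

Import Order.TTheory GRing.Theory Num.Theory.
Import numFieldNormedType.Exports.

Local Open Scope classical_set_scope.
Local Open Scope ring_scope.
Local Open Scope complex_scope.

(* Euler's integral: this is the Gamma function for x > 0 only. *)
Definition Gamma (R : realType) (x : R) : R :=
  \int[lebesgue_measure]_(u in `]0, +oo[) (u `^ (x - 1) * expR (- u)).

(* Meaningful when x + 1, y + 1 and x - y + 1 are positive. *)
Definition gbinom (R : realType) (x y : R) : R :=
  Gamma (x + 1) / (Gamma (y + 1) * Gamma (x - y + 1)).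

(* R[i] is topologized by its modulus through its regular-module alias R[i]^o.
   tail_sum n u is the limit of the partial sums u n + ... + u (N - 1); it is an
   unspecified value unless tail_summable n u holds. *)
Definition tail_summable (R : realType) (n : nat) (u : nat -> R[i]) : Prop :=
  cvgn (fun N => \sum_(n <= j < N) u j : R[i]^o).

Definition tail_sum (R : realType) (n : nat) (u : nat -> R[i]) : R[i] :=
  limn (fun N => \sum_(n <= j < N) u j : R[i]^o).

Definition kcoef (R : realType) (g : R[i]) (n : nat) : R[i] :=
  (\prod_(i < n) (g + i%:R)) / n`!%:R.

Definition Sop_term (R : realType) (t : R) (f : nat -> R[i]) (n j : nat) : R[i] :=
  'C(j, n)%:R * (1 - expR (- t))%:C ^+ (j - n) * f j.

Definition Sop_defined (R : realType) (t : R) (f : nat -> R[i]) : Prop :=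
  forall n, tail_summable n (Sop_term t f n).

Definition Sop (R : realType) (t : R) (f : nat -> R[i]) (n : nat) : R[i] :=
  (expR (- (t * n%:R)))%:C * tail_sum n (Sop_term t f n).

Definition Wneg_term (R : realType) (a : R) (f : nat -> R[i]) (n j : nat) :
  R[i] := kcoef a%:C (j - n) * f j.

Definition Wneg_defined (R : realType) (a : R) (f : nat -> R[i]) : Prop :=
  forall n, tail_summable n (Wneg_term a f n).

(* The fractional sum of order a, i.e. the difference of order -a, for a > 0. *)
Definition Wneg (R : realType) (a : R) (f : nat -> R[i]) (n : nat) : R[i] :=
  tail_sum n (Wneg_term a f n).

Definition W1 (R : realType) (f : nat -> R[i]) (n : nat) : R[i] :=
  f n - f n.+1.

(* For 0 <= a. At an integer a (in particular a = 0) this is the iterated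
   difference; the general formula gives the same there, see W_integer. *)
Definition W (R : realType) (a : R) (f : nat -> R[i]) : nat -> R[i] :=
  let m := (Num.truncn a).+1 in
  if a \is a Num.nat then iter (Num.truncn a) (@W1 R) f
  else iter m (@W1 R) (Wneg (m%:R - a) f).

Definition W_defined (R : realType) (a : R) (f : nat -> R[i]) : Prop :=
  a \is a Num.nat \/ Wneg_defined ((Num.truncn a).+1%:R - a) f.

Lemma W_integer (R : realType) (a : R) (f : nat -> R[i])
    (m := (Num.truncn a).+1) :
  a \is a Num.nat -> Wneg_defined (m%:R - a) f ->
  W a f = iter m (@W1 R) (Wneg (m%:R - a) f).
Proof.
move=> aN; have -> : m%:R - a = 1.
  by rewrite /m -natr1 (truncnK aN) addrAC subrr add0r.
have k1 n : kcoef (1%:C : R[i]) n = 1.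
  rewrite /kcoef; have -> : \prod_(i < n) ((1%:C : R[i]) + i%:R) = n`!%:R.
    elim: n => [|n IHn]; first by rewrite big_ord0.
    by rewrite big_ord_recr/= IHn factS mulnC natrM rmorph1 nat1r.
  by rewrite divff// pnatr_eq0 -lt0n fact_gt0.
have tE n : Wneg_term 1 f n = f.
  by apply/funext => j; rewrite /Wneg_term k1 mul1r.
move=> fS; rewrite /W aN iterSr; congr iter; apply/funext => n.
rewrite /W1 /Wneg !tE /tail_sum.
have cn := fS n.+1; rewrite tE /tail_summable in cn.
suff -> : limn (fun N => \sum_(n <= j < N) f j : R[i]^o) =
    f n + limn (fun N => \sum_(n.+1 <= j < N) f j : R[i]^o) by rewrite addrK.
apply/cvg_lim => //.
apply: cvg_trans; last exact: (cvgD (@cvg_cst _ (f n : R[i]^o) _ _ _) cn).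
apply: near_eq_cvg; near=> N => /=.
rewrite /= [RHS]big_ltn//; near: N; exact: nbhs_infty_gt.
Unshelve. all: by end_near. Qed.

(* Main.v *)
(**
Since f vanishes from some M on, all series are finite sums and W^a f(n) is
the sum over n <= j < M of k^{-a}(j-n) f(j).  With q = 1 - e^{-t} and b = -a the
first formula then reduces, coefficient by coefficient, to
  sum_i k^b(i) (1-q)^i C(n+c, c-i) q^{c-i}
    = sum_i k^{n+1-b}(i) q^i k^b(c-i),
which are the coefficients of z^c in (1-qz)^{b-n-1} (1-z)^{-b}.  Both sides are
polynomials in b, so it suffices to check b = -m for natural m, by induction
on m with the Pascal rules.  The binomial C(j+a, n+a) is
k^{n+a+1}(j-n) by the functional equation of Gamma.
*)

Require Import Defs.
From HB Require Import structures.
From mathcomp Require Import all_boot all_order all_algebra.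
From mathcomp Require Import complex ring.
From mathcomp Require Import all_classical all_reals all_analysis.
From mathcomp Require Import measurable_realfun.

Set Implicit Arguments.
Unset Strict Implicit.
Unset Printing Implicit Defensive.

Import Order.TTheory GRing.Theory Num.Theory.
Import numFieldNormedType.Exports.

Local Open Scope classical_set_scope.
Local Open Scope ring_scope.
Local Open Scope complex_scope.

(** * Coefficients of (1 - z)^(-g) and a convolution identity at negative integers *)

(* Convertible to [kcoef] when [F] is [R[i]]. *)
Definition rbin (F : numFieldType) (g : F) (n : nat) : F :=
  (\prod_(i < n) (g + i%:R)) / n`!%:R.

Lemma rbin0 (F : numFieldType) (g : F) : rbin g 0 = 1.
Proof. by rewrite /rbin big_ord0 fact0 divr1. Qed.

(** Coefficient of z^(n+1) in (1 - z)^(-g) = (1 - z)^(1-g) + z (1 - z)^(-g). In the products, g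
    (g+1) ... (g+n-1) is a factor common to all three terms. *)
Lemma rbinS (F : numFieldType) (g : F) (n : nat) :
  rbin g n.+1 = rbin (g - 1) n.+1 + rbin g n.
Proof.
have n0 : n`!%:R != 0 :> F by rewrite pnatr_eq0 -lt0n fact_gt0.
have n1 : n.+1%:R != 0 :> F by rewrite pnatr_eq0.
rewrite /rbin [X in _ = X / _ + _]big_ord_recl big_ord_recr/= addr0.
under [X in _ = _ * X / _ + _]eq_bigr => i _.
  rewrite /bump/= natrD addrA subrK; over.
set P := \prod_(i < n) _; rewrite factS natrM.
rewrite -[n.+1%:R]natr1 in n1 *.
have key (x y z : F) : x != 0 -> y + 1 != 0 ->
    z * (g + y) / ((y + 1) * x) = (g - 1) * z / ((y + 1) * x) + z / x.
  by move=> x0 y0; field; rewrite x0 y0.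
exact: key.
Qed.

Lemma rbin_natS (F : numFieldType) (n c : nat) :
  rbin (n.+1%:R : F) c = 'C(n + c, c)%:R.
Proof.
elim: n c => [|n IHn] c; first elim: c => [|c IHc].
- by rewrite rbin0 bin0.
- rewrite rbinS IHc !binn subrr /rbin big_ord_recl addr0 mul0r mul0r.
  by rewrite add0r.
- elim: c => [|c IHc]; first by rewrite rbin0 bin0.
  rewrite rbinS IHc -[n.+2%:R]natr1 addrK IHn addSnnS (addSn n).
  by rewrite binS natrD.
Qed.

Lemma rbin00 (F : numFieldType) (n : nat) : rbin (0 : F) n = (n == 0)%:R.
Proof.
by case: n => [|n]; rewrite ?rbin0// /rbin big_ord_recl addr0 !mul0r.
Qed.

(** The generating function (1 - q z)^(-n-1-m) (1 - z)^m, taken at (m+1, n), is 1 - z times the one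
    at (m, n+1); hence the induction on [m] keeps [n] and [c] general. *)
Lemma rbin_conv_nat (F : numFieldType) (q : F) (m n c : nat) :
  \sum_(i < c.+1)
     rbin (- m%:R) i * (1 - q) ^+ i * 'C(n + c, c - i)%:R * q ^+ (c - i) =
  \sum_(i < c.+1) rbin (n.+1%:R + m%:R) i * q ^+ i * rbin (- m%:R) (c - i).
Proof.
elim: m n c => [|m IHm] n c.
  rewrite oppr0 addr0 big_ord_recl/= rbin0 subn0 expr0 !mul1r.
  rewrite big1 ?addr0; last by move=> i _; rewrite rbin00 !mul0r.
  rewrite big_ord_recr/= subnn rbin0 mulr1 big1 ?add0r ?rbin_natS//.
  by move=> i _; rewrite rbin00 subn_eq0 leqNgt ltn_ord mulr0.
case: c => [|c]; first by rewrite !big_ord1 !rbin0/= subnn bin0 !mulr1.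
have kN i : rbin (- m.+1%:R) i.+1 =
    rbin (- m%:R) i.+1 - rbin (- m%:R) i :> F.
  by rewrite [rbin (- m%:R) _]rbinS addrK -natr1 opprD.
have key1 (x y z u v w : F) :
    (x - y) * (z * u) * v * w = x * (z * u) * v * w - y * (z * u) * v * w.
  by ring.
have key2 (k u x y w : F) :
    k * u * y * (q * w) - k * ((1 - q) * u) * x * w =
    k * u * (y + x) * (q * w) - k * u * x * w.
  by ring.
(* The left side at (m+1, n, c+1) is the one at (m, n+1, c+1) minus the one at (m, n+1, c): [kN]
   splits the coefficient, then Pascal's rule for the binomial absorbs the factor 1 - q. *)
transitivity (\sum_(i < c.+2) rbin (- m%:R) i * (1 - q) ^+ i *
      'C(n.+1 + c.+1, c.+1 - i)%:R * q ^+ (c.+1 - i) -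
    \sum_(i < c.+1) rbin (- m%:R) i * (1 - q) ^+ i *
      'C(n.+1 + c, c - i)%:R * q ^+ (c - i)).
  have -> : \sum_(i < c.+2) rbin (- m.+1%:R) i * (1 - q) ^+ i *
        'C(n + c.+1, c.+1 - i)%:R * q ^+ (c.+1 - i) =
      \sum_(i < c.+2) rbin (- m%:R) i * (1 - q) ^+ i *
        'C(n + c.+1, c.+1 - i)%:R * q ^+ (c.+1 - i) -
      \sum_(i < c.+1) rbin (- m%:R) i * (1 - q) ^+ i.+1 *
        'C(n + c.+1, c - i)%:R * q ^+ (c - i).
    rewrite !(big_ord_recl c.+1)/= !rbin0 -addrA -sumrB; congr (_ + _).
    apply: eq_bigr => i _; rewrite /bump/= add1n subSS kN exprS; exact: key1.
  rewrite (big_ord_recr c.+1) [in RHS](big_ord_recr c.+1)/= !subnn !bin0.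
  rewrite addrAC [in RHS]addrAC -!sumrB; congr (_ + _).
  apply: eq_bigr => i _.
  have ic : (i <= c)%N by rewrite -ltnS.
  rewrite (subSn ic) addSn binS natrD addSnnS !exprS.
  exact: key2.
rewrite !IHm (big_ord_recr c.+1) [in RHS](big_ord_recr c.+1)/= subnn !rbin0.
have -> : n.+2%:R + m%:R = n.+1%:R + m.+1%:R :> F.
  by rewrite -!natrD addSnnS.
rewrite addrAC -sumrB; congr (_ + _).
apply: eq_bigr => i _; have ic : (i <= c)%N by rewrite -ltnS.
by rewrite (subSn ic) kN mulrBr.
Qed.

(** * Extension to all parameters by a polynomial argument *)

Definition kpoly (F : numFieldType) (n : nat) : {poly F} :=
  n`!%:R^-1 *: \prod_(i < n) ('X + i%:R%:P).

Lemma horner_kpoly (F : numFieldType) (g : F) (n : nat) :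
  (kpoly F n).[g] = rbin g n.
Proof.
rewrite /kpoly hornerZ horner_prod mulrC /rbin; congr (_ / _).
by apply: eq_bigr => i _; rewrite hornerD hornerX hornerC.
Qed.

(** In characteristic zero the points 0, -1, -2, ... are distinct, and the first [size p] of them
    would be more roots than a nonzero [p] can have. *)
Lemma poly_nat_eq0 (F : numFieldType) (p : {poly F}) :
  (forall m : nat, p.[- m%:R] = 0) -> p = 0.
Proof.
move=> p0; apply/eqP/negPn/negP => pN0.
have := @max_poly_roots _ p [seq - m%:R | m <- iota 0 (size p)] pN0.
rewrite size_map size_iota ltnn => H; apply: notF; apply: H.
  by apply/allP => _ /mapP[m _ ->]; apply/eqP; rewrite p0.
rewrite map_inj_uniq ?iota_uniq// => i j /oppr_inj/eqP.
by rewrite eqr_nat => /eqP.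
Qed.

Lemma rbin_conv (F : numFieldType) (q b : F) (n c : nat) :
  \sum_(i < c.+1)
     rbin b i * (1 - q) ^+ i * 'C(n + c, c - i)%:R * q ^+ (c - i) =
  \sum_(i < c.+1) rbin (n.+1%:R - b) i * q ^+ i * rbin b (c - i).
Proof.
(* The two sides with [b] replaced by the indeterminate; composition with n+1 - X produces the
   coefficient at n+1 - b. *)
pose P : {poly F} := \sum_(i < c.+1)
  ((1 - q) ^+ i * 'C(n + c, c - i)%:R * q ^+ (c - i)) *: kpoly F i.
pose Q : {poly F} := \sum_(i < c.+1)
  q ^+ i *: ((kpoly F i \Po (n.+1%:R%:P - 'X)) * kpoly F (c - i)).
have PE x : P.[x] = \sum_(i < c.+1)
    rbin x i * (1 - q) ^+ i * 'C(n + c, c - i)%:R * q ^+ (c - i).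
  rewrite horner_sum; apply: eq_bigr => i _.
  by rewrite hornerZ horner_kpoly; ring.
have QE x : Q.[x] = \sum_(i < c.+1)
    rbin (n.+1%:R - x) i * q ^+ i * rbin x (c - i).
  rewrite horner_sum; apply: eq_bigr => i _.
  rewrite hornerZ hornerM horner_comp !horner_kpoly hornerD hornerN hornerX.
  by rewrite hornerC; ring.
rewrite -PE -QE; congr (_.[_]); apply/eqP; rewrite -subr_eq0; apply/eqP.
apply: poly_nat_eq0 => m.
by rewrite hornerD hornerN PE QE opprK rbin_conv_nat subrr.
Qed.

(** * The Gamma function at arguments x >= 1: functional equation, finiteness, positivity *)

Definition Gamma_fun (R : realType) (x u : R) : R := u `^ (x - 1) * expR (- u).

(** Kept in the extended reals, so that integrals of nonnegative functions can be handled before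
    finiteness is known; [Gamma] is its [fine] part. *)
Definition eGamma (R : realType) (x : R) : \bar R :=
  (\int[lebesgue_measure]_(u in `]0%R, +oo[) (Gamma_fun x u)%:E)%E.

Lemma Gamma_fun_ge0 (R : realType) (x u : R) : 0 <= Gamma_fun x u.
Proof. by rewrite mulr_ge0 ?powR_ge0 ?expR_ge0. Qed.

Lemma measurable_Gamma_fun (R : realType) (x : R) (D : set R) :
  measurable D -> measurable_fun D (fun u => (Gamma_fun x u)%:E : \bar R).
Proof.
move=> mD; apply: (@measurable_funS _ _ _ _ setT) => //.
apply/measurable_EFinP; apply: measurable_funM.
  exact: measurable_realfun.measurable_powR.
apply: measurableT_comp; first exact: measurable_realfun.measurable_expR.
exact: measurable_realfun.oppr_measurable.
Qed.

(** For u >= 1 and a natural N >= x, u^x <= u^N, while e^u >= u^(N+1) / (N+1)!; so the product is at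
    most (N+1)! / u. *)
Lemma powR_expR_cvg0 (R : realType) (x : R) :
  u `^ x * expR (- u) @[u --> +oo] --> (0 : R).
Proof.
apply/cvgr0Pnorm_le => e e0.
have [N xN] : exists N, x <= N%:R.
  exists (Num.truncn `|x|).+1.
  by rewrite ltW// (le_lt_trans (ler_norm x))// truncnS_gt.
near=> u.
have u1 : 1 <= u by near: u; exact: nbhs_pinfty_ge.
have u0 : 0 < u by exact: lt_le_trans u1.
rewrite ger0_norm ?mulr_ge0 ?powR_ge0 ?expR_ge0//.
apply: (@le_trans _ _ (u ^+ N * expR (- u))).
  rewrite ler_wpM2r ?expR_ge0// -powR_mulrn ?(ltW u0)//.
  by rewrite ler_powR.
rewrite expRN ler_pdivrMr ?expR_gt0//.
have h := expR_ge1Dxn N (ltW u0).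
apply: (@le_trans _ _ (e * (u ^+ N.+1 / N.+1`!%:R))); last first.
  by rewrite ler_pM2l// (le_trans _ h)// lerDr.
have f0 : 0 < (N.+1)`!%:R :> R by rewrite ltr0n fact_gt0.
have -> : e * (u ^+ N.+1 / N.+1`!%:R) = u ^+ N * (e * u / N.+1`!%:R).
  by rewrite exprSr mulrCA -!mulrA; congr (_ * _); rewrite mulrCA !mulrA.
rewrite ler_peMr ?exprn_ge0 ?(ltW u0)//.
rewrite ler_pdivlMr// mul1r mulrC -ler_pdivrMr//.
Unshelve. all: by end_near. Qed.

Lemma cvg_Gamma_fun_pinfty (R : realType) (x : R) :
  Gamma_fun x u @[u --> +oo] --> (0 : R).
Proof. exact: powR_expR_cvg0. Qed.

(** Supplies the antiderivatives for the functional equation and, at x = 0, for the integral of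
    e^(-u). *)
Lemma is_derive_Gamma_fun (R : realType) (x u : R) : 0 < u ->
  is_derive u 1 (Gamma_fun (x + 1)) (x * Gamma_fun x u - Gamma_fun (x + 1) u).
Proof.
move=> u0; rewrite /Gamma_fun addrK.
have dp := is_derive1_powR x u0.
apply: is_derive_eq.
rewrite /GRing.scale/=; ring.
Qed.

Lemma continuous_Gamma_fun (R : realType) (x u : R) : 0 < u ->
  {for u, continuous (Gamma_fun x)}.
Proof.
move=> u0; rewrite -[x](subrK 1).
apply: differentiable_continuous; apply/derivable1_diffP.
exact: (@ex_derive _ _ _ _ _ _ _ (is_derive_Gamma_fun (x - 1) u0)).
Qed.

Lemma cvg_Gamma_fun0 (R : realType) (x : R) : 1 <= x ->
  Gamma_fun x u @[u --> 0^'+] --> Gamma_fun x 0.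
Proof.
move=> x1; apply: cvgM; last first.
  apply: cvg_at_right_filter.
  apply: (@continuous_comp _ _ _ (fun u : R => - u) expR).
    exact: opp_continuous.
  exact: continuous_expR.
(* At x = 1 the power is constantly 1, with 0^0 = 1; for x > 1 it tends to 0. *)
have [->|xN1] := eqVneq x 1.
  rewrite subrr powRr0; under eq_fun do rewrite powRr0; exact: cvg_cst.
rewrite powR0 ?subr_eq0//; apply: powR_cvg0.
by rewrite subr_gt0 lt_neqAle eq_sym xN1.
Qed.

Lemma eGammaE (R : realType) (x : R) :
  eGamma x = (\int[lebesgue_measure]_(u in `[0%R, +oo[) (Gamma_fun x u)%:E)%E.
Proof.
by rewrite /eGamma integral_itv_obnd_cbnd//; exact: measurable_Gamma_fun.
Qed.

Lemma Gamma_fun10 (R : realType) : Gamma_fun 1 (0 : R) = 1.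
Proof. by rewrite /Gamma_fun subrr powRr0 oppr0 expR0 mulr1. Qed.

Lemma GammaE (R : realType) (x : R) : Gamma x = fine (eGamma x).
Proof. by []. Qed.

(** The antiderivative is [- Gamma_fun 1]. The case b = 0 gives Gamma(1) = 1, the case b = 1 a
    positive lower bound for Gamma. *)
Lemma eGamma_tail1 (R : realType) (b : R) : 0 <= b ->
  (\int[lebesgue_measure]_(u in `[b, +oo[) (Gamma_fun 1 u)%:E =
  (expR (- b))%:E)%E.
Proof.
move=> b0; rewrite (@ge0_continuous_FTC2y _ _ (fun u => - Gamma_fun 1 u) _ 0).
- by rewrite EFinN oppeK add0e /Gamma_fun subrr powRr0 mul1r.
- by move=> u _; exact: Gamma_fun_ge0.
- apply/continuous_within_itvcyP; split.
    move=> u; rewrite in_itv/= andbT => bu.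
    by apply: continuous_Gamma_fun; exact: le_lt_trans bu.
  move: b0; rewrite le_eqVlt => /predU1P[<-|b0]; first exact: cvg_Gamma_fun0.
  by apply: cvg_at_right_filter; exact: continuous_Gamma_fun.
- rewrite -oppr0; apply: cvgN; exact: cvg_Gamma_fun_pinfty.
- move=> u bu; have := is_derive_Gamma_fun 0 (le_lt_trans b0 bu).
  by rewrite add0r => dG; exact: ex_derive.
- apply: cvgN; move: b0; rewrite le_eqVlt => /predU1P[<-|b0].
    exact: cvg_Gamma_fun0.
  by apply: cvg_at_right_filter; exact: continuous_Gamma_fun.
- move=> u; rewrite in_itv/= andbT => bu; have u0 := le_lt_trans b0 bu.
  have dG := is_derive_Gamma_fun 0 u0; rewrite add0r in dG.
  by rewrite derive1E deriveN ?ex_derive// derive_val mul0r sub0r opprK.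
Qed.

Lemma eGamma1 (R : realType) : eGamma (1 : R) = 1%E.
Proof. by rewrite eGammaE eGamma_tail1// oppr0 expR0. Qed.

(* The constant [c = x `^ x] makes [u `^ x + c - x * u `^ (x - 1)] nonnegative,
   so that the nonnegative form of the fundamental theorem applies. *)
Lemma eGammaS (R : realType) (x : R) : 1 <= x ->
  eGamma (x + 1) = (x%:E * eGamma x)%E.
Proof.
move=> x1; have x0 : 0 < x by exact: lt_le_trans x1.
set c := x `^ x; have c0 : 0 <= c by exact: powR_ge0.
pose f u := Gamma_fun (x + 1) u + c * Gamma_fun 1 u - x * Gamma_fun x u.
have f0 u : 0 <= u -> 0 <= f u.
  move=> u0; rewrite /f /Gamma_fun addrK subrr powRr0 !mulrA -mulrDl -mulrBl.
  rewrite mulr_ge0 ?expR_ge0// mulr1 subr_ge0.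
  (* For u <= x, x u^(x-1) <= x x^(x-1) = c; for u >= x, x u^(x-1) <= u^x. *)
  have [ux|/ltW xu] := leP u x.
    apply: (@le_trans _ _ c); last by rewrite lerDr powR_ge0.
    rewrite /c -[in leRHS]mulr_powRB1 ?(ltW x0)//.
    by rewrite ler_wpM2l ?(ltW x0)// ge0_ler_powR ?subr_ge0// nnegrE (ltW x0).
  apply: (@le_trans _ _ (u `^ x)); last by rewrite lerDl.
  by rewrite -[in leRHS]mulr_powRB1// ler_wpM2r ?powR_ge0.
(* [F] is an antiderivative of [f] that tends to 0 at infinity and equals -c at 0. *)
have intf : (\int[lebesgue_measure]_(u in `[0%R, +oo[) (f u)%:E = c%:E)%E.
  pose F u := - (Gamma_fun (x + 1) u + c * Gamma_fun 1 u).
  rewrite (@ge0_continuous_FTC2y _ _ F _ 0)//.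
  - rewrite /F Gamma_fun10 mulr1 {1}/Gamma_fun addrK powR0 ?gt_eqF//.
    by rewrite mul0r !add0r EFinN oppeK.
  - apply/continuous_within_itvcyP; split.
      move=> u; rewrite in_itv/= andbT => u0.
      by apply: cvgB; [apply: cvgD; [|apply: cvgMr]|apply: cvgMr];
        exact: continuous_Gamma_fun.
    by apply: cvgB; [apply: cvgD; [|apply: cvgMr]|apply: cvgMr];
      apply: cvg_Gamma_fun0; rewrite ?lerDr ?(ltW x0).
  - rewrite -oppr0; apply: cvgN; rewrite -[0]addr0; apply: cvgD.
      exact: cvg_Gamma_fun_pinfty.
    rewrite -[0](mulr0 c); apply: cvgMr; exact: cvg_Gamma_fun_pinfty.
  - move=> u u0; have := is_derive_Gamma_fun x u0.
    have := is_derive_Gamma_fun 0 u0; rewrite add0r => d1 d2.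
    exact: ex_derive.
  - by apply: cvgN; apply: cvgD; [|apply: cvgMr];
      apply: cvg_Gamma_fun0; rewrite ?lerDr ?(ltW x0).
  - move=> u; rewrite in_itv/= andbT => u0; have := is_derive_Gamma_fun x u0.
    have := is_derive_Gamma_fun 0 u0; rewrite add0r => d1 d2.
    rewrite derive1E; apply: derive_val; apply: is_derive_eq.
    rewrite /f /GRing.scale/=; ring.
(* All integrands are nonnegative on the half-line, so additivity holds without integrability;
   afterwards only the finite [c] is cancelled. *)
have key : (c%:E + x%:E * eGamma x = c%:E + eGamma (x + 1))%E.
  have m0 := @measurable_Gamma_fun R.
  have cM (y : R) k : 0 <= k -> (k%:E * eGamma y =
      \int[lebesgue_measure]_(u in `[0%R, +oo[) (k * Gamma_fun y u)%:E)%E.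
    move=> k0; rewrite eGammaE -ge0_integralZl_EFin//.
      by move=> u _; rewrite lee_fin Gamma_fun_ge0.
    exact: m0.
  have mM (y k : R) (D : set R) : measurable D ->
      measurable_fun D (fun u => (k * Gamma_fun y u)%:E : \bar R).
    move=> mD; apply/measurable_EFinP; apply: measurable_funM => //.
    by apply/measurable_EFinP; exact: m0.
  have mf (D : set R) : measurable D ->
      measurable_fun D (fun u => (f u)%:E : \bar R).
    move=> mD; apply/measurable_EFinP; apply: measurable_funB;
      first apply: measurable_funD; apply/measurable_EFinP;
      [exact: m0|exact: mM|exact: mM].
  rewrite -{1}intf cM ?(ltW x0)// -ge0_integralD//.
  - rewrite -[c%:E]mule1 -eGamma1 cM// addeC eGammaE -ge0_integralD//.
    + by apply: eq_integral => u _; rewrite -!EFinD /f subrK.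
    + by move=> u _; rewrite lee_fin Gamma_fun_ge0.
    + exact: m0.
    + by move=> u _; rewrite lee_fin mulr_ge0 ?Gamma_fun_ge0.
    + exact: mM.
  - by move=> u; rewrite /= in_itv/= andbT => u0; rewrite lee_fin f0.
  - exact: mf.
  - by move=> u _; rewrite lee_fin mulr_ge0 ?Gamma_fun_ge0 ?(ltW x0).
  - exact: mM.
by rewrite -[LHS](@addeK _ c%:E)// [(_ + c%:E)%E]addeC -key
  [(c%:E + _)%E]addeC addeK.
Qed.

Lemma eGamma_nat (R : realType) (n : nat) : eGamma (n.+1%:R : R) = n`!%:R%:E.
Proof.
elim: n => [|n IHn]; first exact: eGamma1.
by rewrite -natr1 eGammaS ?IHn ?ler1n// -EFinM -natrM -factS.
Qed.

(** Domination u^(x-1) <= 1 + u^N with N > x, checked separately for u <= 1 and u >= 1; the two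
    terms integrate to Gamma(1) and Gamma(N+1) = N!. *)
Lemma eGamma_fin_num (R : realType) (x : R) : 1 <= x -> eGamma x \is a fin_num.
Proof.
move=> x1; pose N := (Num.truncn x).+1.
have xN : x <= N.+1%:R by rewrite ltW// (lt_trans (truncnS_gt x))// ltr_nat.
rewrite ge0_fin_numE; last first.
  by apply: integral_ge0 => u _; rewrite lee_fin Gamma_fun_ge0.
apply: (@le_lt_trans _ _ (eGamma 1 + eGamma N.+1%:R)%E); last first.
  by rewrite eGamma1 eGamma_nat -EFinD ltry.
rewrite /eGamma -ge0_integralD//;
  try (by move=> u _; rewrite lee_fin Gamma_fun_ge0);
  try exact: measurable_Gamma_fun.
apply: ge0_le_integral => //;
  try (by move=> u _; rewrite lee_fin Gamma_fun_ge0);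
  try exact: measurable_Gamma_fun.
  by apply: emeasurable_funD; exact: measurable_Gamma_fun.
move=> u; rewrite /= in_itv/= andbT => u0.
rewrite -EFinD lee_fin /Gamma_fun -mulrDl.
rewrite ler_wpM2r ?expR_ge0// subrr powRr0.
have [u1|/ltW u1] := leP u 1.
  rewrite ler_wpDr ?powR_ge0//.
  apply: (@le_trans _ _ (1 `^ (x - 1))); last by rewrite powR1.
  by rewrite ge0_ler_powR ?subr_ge0 ?nnegrE ?(ltW u0).
by rewrite ler_wpDl// ler_powR// lerB.
Qed.

(** For u >= 1 the integrand is at least e^(-u), whose integral over that range is e^(-1). *)
Lemma eGamma_gt0 (R : realType) (x : R) : 1 <= x -> (0 < eGamma x)%E.
Proof.
move=> x1; apply: (@lt_le_trans _ _ (expR (- 1))%:E).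
  by rewrite lte_fin expR_gt0.
rewrite -eGamma_tail1// eGammaE.
apply: (@le_trans _ _
  (\int[lebesgue_measure]_(u in `[1%R, +oo[) (Gamma_fun x u)%:E)%E).
  apply: ge0_le_integral => //;
  try (by move=> u _; rewrite lee_fin Gamma_fun_ge0);
    try exact: measurable_Gamma_fun.
  move=> u; rewrite /= in_itv/= andbT => u1.
  rewrite lee_fin ler_wpM2r ?expR_ge0//.
  by rewrite ler_powR// lerB.
apply: ge0_subset_integral => //;
  try (by move=> u _; rewrite lee_fin Gamma_fun_ge0);
  try exact: measurable_Gamma_fun.
by apply: subset_itvr; rewrite bnd_simp.
Qed.

Lemma GammaS (R : realType) (x : R) : 1 <= x -> Gamma (x + 1) = x * Gamma x.
Proof. by move=> x1; rewrite !GammaE eGammaS// fineM// eGamma_fin_num. Qed.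

Lemma Gamma_gt0 (R : realType) (x : R) : 1 <= x -> 0 < Gamma x.
Proof.
by move=> x1; rewrite fine_gt0// eGamma_gt0//= ltey_eq eGamma_fin_num.
Qed.

Lemma GammaS_nat (R : realType) (n : nat) : Gamma (n%:R + 1 : R) = n`!%:R.
Proof. by rewrite natr1 GammaE eGamma_nat. Qed.

Lemma GammaD_nat (R : realType) (x : R) (n : nat) : 1 <= x ->
  Gamma (x + n%:R) = (\prod_(i < n) (x + i%:R)) * Gamma x.
Proof.
move=> x1; elim: n => [|n IHn]; first by rewrite big_ord0 mul1r addr0.
rewrite -natr1 addrA GammaS ?IHn ?big_ord_recr/= ?ler_wpDr//.
by rewrite mulrA [_ * (x + _)]mulrC.
Qed.

(** * Tail sums and fractional differences of finitely supported sequences *)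

Lemma sum_nat_vanish (V : nmodType) (u : nat -> V) (M n N : nat) :
  (forall j, (M <= j)%N -> u j = 0) -> (M <= N)%N ->
  \sum_(n <= j < N) u j = \sum_(n <= j < M) u j.
Proof.
move=> u0 MN; have [nM|Mn] := leqP n M.
  rewrite (big_cat_nat nM MN)/= [X in _ + X]big1_seq ?addr0// => j.
  by rewrite mem_index_iota => /andP[_ /andP[Mj _]]; exact: u0.
rewrite [RHS]big_geq 1?ltnW// big1_seq// => j.
rewrite mem_index_iota => /andP[_ /andP[nj _]]; apply: u0.
exact: leq_trans (ltnW Mn) nj.
Qed.

(** The partial sums are constant from N = M on, which gives both convergence and the value. *)
Lemma tail_sum_vanish (R : realType) (u : nat -> R[i]) (M n : nat) :
  (forall j, (M <= j)%N -> u j = 0) ->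
  tail_summable n u /\ tail_sum n u = \sum_(n <= j < M) u j.
Proof.
move=> u0.
have h : (fun N => \sum_(n <= j < N) u j : R[i]^o) @ \oo -->
    (\sum_(n <= j < M) u j : R[i]^o).
  apply: cvg_near_cst; near=> N; apply: sum_nat_vanish => //.
  by near: N; exact: nbhs_infty_ge.
split; first by apply/cvg_ex; exists (\sum_(n <= j < M) u j : R[i]^o).
have hR : hausdorff_space (R[i]^o) by [].
exact: (cvg_lim hR h).
Unshelve. all: by end_near. Qed.

(** The fractional sum of order [b], cut off at [M]. Since [b] is any scalar, fractional sums, the
    identity and fractional differences form one family. *)
Definition fconv (F : numFieldType) (M : nat) (b : F) (f : nat -> F)
    (n : nat) : F :=
  \sum_(n <= j < M) rbin b (j - n) * f j.

Lemma fconv_ge (F : numFieldType) (M : nat) (b : F) (f : nat -> F) (n : nat) :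
  (M <= n)%N -> fconv M b f n = 0.
Proof. by move=> Mn; rewrite /fconv big_geq. Qed.

(** Pascal's rule [rbinS] term by term; at j = n both coefficients are 1. *)
Lemma fconvB1 (F : numFieldType) (M : nat) (b : F) (f : nat -> F) (n : nat) :
  fconv M b f n - fconv M b f n.+1 = fconv M (b - 1) f n.
Proof.
have [Mn|nM] := leqP M n; first by rewrite !fconv_ge ?subrr// ltnW.
rewrite /fconv big_ltn// [RHS]big_ltn// subnn !rbin0 -addrA; congr (_ + _).
rewrite -sumrB; apply: eq_big_nat => j /andP[nj _].
by rewrite -mulrBl -(subnSK nj) rbinS addrK.
Qed.

Lemma fconv0 (F : numFieldType) (M : nat) (f : nat -> F) (n : nat) :
  (forall j, (M <= j)%N -> f j = 0) -> fconv M 0 f n = f n.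
Proof.
move=> f0; have [Mn|nM] := leqP M n; first by rewrite fconv_ge// f0.
rewrite /fconv big_ltn// subnn rbin0 mul1r big1_seq ?addr0// => j.
rewrite mem_index_iota => /andP[_ /andP[nj _]].
by rewrite rbin00 subn_eq0 leqNgt nj mul0r.
Qed.

(** * Fractional differences of the binomial sums defining S(t) *)

Lemma sum_nat_triangle (V : nmodType) (n M : nat) (G : nat -> nat -> V) :
  \sum_(n <= l < M) \sum_(l <= j < M) G l j =
  \sum_(n <= j < M) \sum_(n <= l < j.+1) G l j.
Proof.
pose P l j := (l <= j)%N.
transitivity (\sum_(n <= l < M) \sum_(n <= j < M | P l j) G l j).
  apply: eq_big_nat => l /andP[nl lM].
  rewrite (big_cat_nat nl (ltnW lM))/= [X in _ = X + _]big1_seq ?add0r;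
    last first.
    move=> j; rewrite mem_index_iota /P => /andP[lj /andP[_ jl]].
    by have := leq_trans jl lj; rewrite ltnn.
  rewrite [LHS]big_nat_cond [RHS]big_nat_cond; apply: eq_bigl => j.
  by rewrite andbT /P; case: (l <= j)%N; rewrite ?andbT.
rewrite (exchange_big_dep_nat predT)//=; apply: eq_big_nat => j /andP[nj jM].
rewrite (@big_cat_nat _ _ _ j.+1) ?(leqW nj)//= [X in _ + X]big1_seq ?addr0;
  last first.
  move=> l; rewrite mem_index_iota /P => /andP[lj /andP[jl _]].
  by have := leq_trans jl lj; rewrite ltnn.
rewrite [LHS]big_nat_cond [RHS]big_nat_cond; apply: eq_bigl => l.
by rewrite /P ltnS; case: (l <= j)%N; rewrite ?andbT ?andbF.
Qed.

(** At b = -a and q = 1 - e^(-t) this is the first formula, with its weights still written as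
    [rbin]. Once both double sums are reordered, the coefficients of [f j] agree by [rbin_conv] with
    c = j - n, up to the common factor (1 - q)^n. *)
Lemma fconv_semigroup (F : numFieldType) (M : nat) (q b : F) (f : nat -> F)
    (n : nat) :
  fconv M b (fun l => (1 - q) ^+ l *
    \sum_(l <= j < M) 'C(j, l)%:R * q ^+ (j - l) * f j) n =
  (1 - q) ^+ n *
    \sum_(n <= j < M) rbin (n.+1%:R - b) (j - n) * q ^+ (j - n) * fconv M b f j.
Proof.
transitivity (\sum_(n <= l < M) \sum_(l <= j < M)
    rbin b (l - n) * (1 - q) ^+ l * 'C(j, l)%:R * q ^+ (j - l) * f j).
  apply: eq_bigr => l _; rewrite mulrA mulr_sumr; apply: eq_bigr => j _.
  by rewrite !mulrA.
transitivity ((1 - q) ^+ n * \sum_(n <= l < M) \sum_(l <= j < M)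
    rbin (n.+1%:R - b) (l - n) * q ^+ (l - n) * rbin b (j - l) * f j);
  last first.
  congr (_ * _); apply: eq_bigr => l _.
  rewrite mulr_sumr; apply: eq_bigr => j _.
  by rewrite !mulrA.
rewrite !sum_nat_triangle mulr_sumr; apply: eq_big_nat => j /andP[nj _].
rewrite -!mulr_suml mulrA; congr (_ * _).
have e (H : nat -> F) : \sum_(n <= l < j.+1) H l =
    \sum_(i < (j - n).+1) H (i + n)%N.
  by rewrite -{1}[n]add0n big_addn subSn// big_mkord.
rewrite !e mulr_sumr.
under [RHS]eq_bigr => i _ do rewrite addnK [(_ + n)%N]addnC subnDA.
rewrite -mulr_sumr -rbin_conv mulr_sumr; apply: eq_bigr => i _.
have ij : (i <= j - n)%N by rewrite -ltnS.
have inj : (i + n <= j)%N by rewrite addnC -leq_subRL.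
rewrite addnK (subnKC nj) exprD [(i + n)%N]addnC subnDA.
(* Symmetry brings the binomial to the form C(n + c, c - i) of [rbin_conv]. *)
have -> : 'C(j, n + i) = 'C(j, j - n - i) by rewrite -subnDA bin_sub// addnC.
by rewrite mulrA [_ * (1 - q) ^+ n]mulrC -!mulrA.
Qed.

Lemma iter_W1_fconv (R : realType) (M m : nat) (b : R[i]) (f : nat -> R[i]) :
  iter m (@W1 R) (fconv M b f) = fconv M (b - m%:R) f.
Proof.
elim: m => [|m IHm]; first by rewrite subr0.
by rewrite iterS IHm; apply/funext => n; rewrite /W1 fconvB1 -natr1 opprD addrA.
Qed.

(** Each difference lowers the order by one. The start is order 0, where the sum is [f] itself, for
    integer [a], and order m - a otherwise; both end at order -a. *)
Lemma W_fconv (R : realType) (a : R) (f : nat -> R[i]) (M : nat) :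
  0 <= a -> (forall j, (M <= j)%N -> f j = 0) ->
  W_defined a f /\ W a f = fconv M (- a%:C) f.
Proof.
move=> a0 f0.
have s0 b n j : (M <= j)%N -> Wneg_term b f n j = 0.
  by move=> Mj; rewrite /Wneg_term f0// mulr0.
split.
  right => n; exact: (tail_sum_vanish n (s0 _ n)).1.
rewrite /W; case: ifPn => aN.
  have -> : f = fconv M 0 f by apply/funext => n; rewrite fconv0.
  rewrite iter_W1_fconv sub0r; congr (fconv _ (- _)).
    by rewrite -{2}(truncnK aN) rmorph_nat.
  by apply/funext => n; rewrite fconv0.
have -> b : Wneg b f = fconv M b%:C f.
  by apply/funext => n; rewrite /Wneg (tail_sum_vanish n (s0 _ n)).2.
by rewrite iter_W1_fconv rmorphB rmorph_nat addrAC subrr sub0r.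
Qed.

(** * Binomial weights and the two formulas for S(t) *)

(** Gamma(j+a+1) / Gamma(n+a+1) is a product of j - n factors starting at n+a+1, which is at least 1
    as [a] is nonnegative; the remaining Gamma(j-n+1) is (j-n)!. *)
Lemma gbinom_rbin (R : realType) (a : R) (n j : nat) : 0 <= a -> (n <= j)%N ->
  (gbinom (j%:R + a) (n%:R + a))%:C = rbin (n.+1%:R + a%:C) (j - n).
Proof.
move=> a0 nj; rewrite /gbinom.
have n1 : 1 <= n%:R + a + 1 by rewrite lerDr addr_ge0.
have -> : j%:R + a + 1 = n%:R + a + 1 + (j - n)%:R :> R.
  by rewrite natrB//; ring.
have -> : j%:R + a - (n%:R + a) + 1 = (j - n)%:R + 1 :> R.
  by rewrite natrB//; ring.
rewrite GammaD_nat// GammaS_nat [_ * Gamma _]mulrC -mulf_div divff ?mul1r;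
  last first.
  by rewrite gt_eqF// Gamma_gt0.
rewrite /rbin fmorph_div rmorph_prod rmorph_nat; congr (_ / _).
apply: eq_bigr => i _; rewrite !rmorphD !rmorph_nat rmorph1 -natr1.
by rewrite [_ + _ + 1]addrAC.
Qed.

(** Both sides are b (b+1) ... (b+j-1) / (n! (j-n)!). *)
Lemma rbinM (F : numFieldType) (b : F) (n j : nat) : (n <= j)%N ->
  rbin b n * rbin (b + n%:R) (j - n) = 'C(j, n)%:R * rbin b j.
Proof.
move=> nj; have f0 k : k`!%:R != 0 :> F by rewrite pnatr_eq0 -lt0n fact_gt0.
rewrite /rbin mulf_div -natrM mulrA; apply/eqP.
rewrite eqr_div ?natrM ?mulf_neq0// -(bin_fact nj) !natrM.
have -> : \prod_(i < j) (b + i%:R) =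
    (\prod_(i < n) (b + i%:R)) * \prod_(i < j - n) (b + n%:R + i%:R).
  rewrite -[in LHS](subnKC nj) big_split_ord/=; congr (_ * _).
  by apply: eq_bigr => i _; rewrite natrD addrA.
by apply/eqP; ring.
Qed.

Lemma expRN_natr (R : realType) (t : R) (n : nat) :
  (expR (- (t * n%:R)))%:C = (1 - (1 - expR (- t))%:C) ^+ n :> R[i].
Proof.
rewrite -mulNr expRM_natr rmorphXn; congr (_ ^+ _).
by rewrite rmorphB rmorph1 opprB addrC subrK.
Qed.

Lemma Sop_vanish (R : realType) (t : R) (f : nat -> R[i]) (M : nat)
    (q := (1 - expR (- t))%:C) :
  (forall j, (M <= j)%N -> f j = 0) -> Sop_defined t f /\
  Sop t f = fun n => (1 - q) ^+ n *
    \sum_(n <= j < M) 'C(j, n)%:R * q ^+ (j - n) * f j.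
Proof.
move=> f0; have s0 n j : (M <= j)%N -> Sop_term t f n j = 0.
  by move=> Mj; rewrite /Sop_term f0// mulr0.
split => [n|]; first exact: (tail_sum_vanish n (s0 n)).1.
apply/funext => n; rewrite /Sop (tail_sum_vanish n (s0 n)).2.
by rewrite expRN_natr.
Qed.

Theorem lemma4p3 (R : realType) (a : R) (f : nat -> R[i])
    (a_ge0 : 0 <= a) (f_fin : finite_set [set n | f n != 0])
    (t : R) (t_ge0 : 0 <= t) :
  let kW (g : nat -> R[i]) := fun n => kcoef (a + 1)%:C n * W a g n in
  let term n j :=
    (gbinom (j%:R + a) (n%:R + a))%:C * (1 - expR (- t))%:C ^+ (j - n)
      * W a f j in
  [/\ Sop_defined t f, W_defined a f & W_defined a (Sop t f)] /\
  (forall n, tail_summable n (term n) /\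
     W a (Sop t f) n = (expR (- (t * n%:R)))%:C * tail_sum n (term n)) /\
  (Sop_defined t (kW f) /\ kW (Sop t f) = Sop t (kW f)).
Proof.
move=> kW term.
have [M f0] : exists M, forall j, (M <= j)%N -> f j = 0.
  have /finite_seqP[s sE] := f_fin.
  (* One more than the largest index of the support; the maximum is 0 if the support is empty. *)
  exists (\max_(i <- s) i).+1 => j Mj; apply/eqP/negPn/negP => fj.
  have : [set` s] j by rewrite -sE.
  move=> /= js; have := @leq_bigmax_seq _ s predT id j js isT.
  by rewrite leqNgt Mj.
set q := (1 - expR (- t))%:C.
have [Sd SE] := Sop_vanish t f0.
(* The same [M] bounds the support of S(t) f, so its difference is a finite convolution as well. *)
have S0 j : (M <= j)%N -> Sop t f j = 0.
  by move=> Mj; rewrite SE big_geq// mulr0.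
have [Wd WE] := W_fconv a_ge0 f0.
have [WSd WSE] := W_fconv a_ge0 S0.
have W0 j : (M <= j)%N -> W a f j = 0 by move=> Mj; rewrite WE fconv_ge.
have WS n : W a (Sop t f) n = (1 - q) ^+ n * \sum_(n <= j < M)
    rbin (n.+1%:R + a%:C) (j - n) * q ^+ (j - n) * W a f j.
  by rewrite WSE SE fconv_semigroup opprK -WE.
have term0 n j : (M <= j)%N -> term n j = 0.
  by move=> Mj; rewrite /term W0// mulr0.
have kW0 j : (M <= j)%N -> kW f j = 0 by move=> Mj; rewrite /kW W0// mulr0.
have [kSd kSE] := Sop_vanish t kW0.
split => //; split; last first.
  (* With (1 - q)^n taken out, the terms agree because k^(a+1)(n) k^(n+1+a)(j-n) = C(j,n)
     k^(a+1)(j), which is [rbinM] at b = a+1. *)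
  split => //; apply/funext => n; rewrite kSE /kW WS mulrCA; congr (_ * _).
  rewrite mulr_sumr; apply: eq_big_nat => j /andP[nj _].
  have -> : n.+1%:R + a%:C = (a + 1)%:C + n%:R.
    by rewrite rmorphD rmorph1 -natr1 addrC addrAC addrA.
  have key (x y z u v w : R[i]) : x * y = z * u ->
      x * (y * v * w) = z * v * (u * w).
    by move=> e; rewrite mulrACA -e !mulrA.
  exact/key/rbinM.
move=> n; have [Td TE] := tail_sum_vanish n (term0 n); split => //.
rewrite WS TE expRN_natr; congr (_ * _).
by apply: eq_big_nat => j /andP[nj _]; rewrite /term gbinom_rbin.
Qed.
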